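(* The data $(U_-,X)$ are informative for deadbeat control if and only if the matrix $X_-$ has full row rank and there exists a right inverse $X_-^\dagger$ of $X_-$ such that $X_+X_-^\dagger$ is nilpotent. Moreover, if this condition is satisfied (with $X_-^\dagger$ such a right inverse), then the feedback gain $K:=U_-X_-^\dagger$ yields a deadbeat controller, that is, $\Sigma_{i/s}\subseteq\Sigma_K^{\mathrm{nil}}$.
   Context: Fix positive integers $n,m,q,T_1,\dots,T_q$. Let $(A_s,B_s)\in\mathbb{R}^{n\times n}\times\mathbb{R}^{n\times m}$ be the 'true' system $x(t+1)=A_sx(t)+B_su(t)$. For $i=1,\dots,q$ let $u^i(0),\dots,u^i(T_i-1)\in\mathbb{R}^m$ and $x^i(0),\dots,x^i(T_i)\in\mathbb{R}^n$ be input/state data generated by this system, i.e. $x^i(t+1)=A_sx^i(t)+B_su^i(t)$ for $t=0,\dots,T_i-1$. Put $U^i_-=[u^i(0)\ \cdots\ u^i(T_i-1)]$, $X^i=[x^i(0)\ \cdots\ x^i(T_i)]$, $X^i_-=[x^i(0)\ \cdots\ x^i(T_i-1)]$, $X^i_+=[x^i(1)\ \cdots\ x^i(T_i)]$, and $U_-=[U^1_-\ \cdots\ U^q_-]$, $X=[X^1\ \cdots\ X^q]$, $X_-=[X^1_-\ \cdots\ X^q_-]$, $X_+=[X^1_+\ \cdots\ X^q_+]$; thus $X_+=A_sX_-+B_sU_-$. The set of systems consistent with the data is $$\Sigma_{i/s}=\Big\{(A,B)\in\mathbb{R}^{n\times n}\times\mathbb{R}^{n\times m}\ \Big|\ X_+=\begin{bmatrix}A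 & B\end{bmatrix}\begin{bmatrix}X_- \\ U_- \end{bmatrix}\Big\}.$$ For $K\in\mathbb{R}^{m\times n}$, $\Sigma_K^{\mathrm{nil}}=\{(A,B)\mid A+BK\text{ is nilpotent}\}$. The data are informative for deadbeat control if there exists $K\in\mathbb{R}^{m\times n}$ with $\Sigma_{i/s}\subseteq\Sigma_K^{\mathrm{nil}}$. A right inverse of $X_-$ is a real matrix $X_-^\dagger$ with $X_-X_-^\dagger=I$. *)

(* Defs.v *)
From HB Require Import structures.
From mathcomp Require Import all_boot all_order all_algebra.
From mathcomp Require Import classical_sets reals.

Set Implicit Arguments.
Unset Strict Implicit.
Unset Printing Implicit Defensive.

Import GRing.Theory.
Local Open Scope ring_scope.
Local Open Scope classical_set_scope.

Definition nilpotent_mx (R : realType) (n : nat) (M : 'M[R]_n) : Prop :=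
  exists k : nat, M ^+ k = 0.

Section Data.
Variables (R : realType) (n m q : nat) (T : 'I_q -> nat).

(* The i-th experiment consists of the inputs u i 0, ..., u i (T i - 1) and
   the states x i 0, ..., x i (T i). *)
Variable u : forall i : 'I_q, 'I_(T i) -> 'cV[R]_m.
Variable x : forall i : 'I_q, 'I_(T i).+1 -> 'cV[R]_n.

(* For t : 'I_k, the indices t and t + 1 seen in 'I_k.+1. *)
Definition time_now (k : nat) (t : 'I_k) : 'I_k.+1 := widen_ord (leqnSn k) t.
Definition time_next (k : nat) (t : 'I_k) : 'I_k.+1 := lift ord0 t.

Definition generated_by (A : 'M[R]_n) (B : 'M[R]_(n, m)) : Prop :=
  forall (i : 'I_q) (t : 'I_(T i)),
    x (time_next t) = A *m x (time_now t) + B *m u t.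

Definition Uminus : 'M[R]_(m, \sum_(i < q) T i) :=
  \mxrow_(i < q) (\matrix_(j < m, t < T i) u t j 0).

Definition Xminus : 'M[R]_(n, \sum_(i < q) T i) :=
  \mxrow_(i < q) (\matrix_(j < n, t < T i) x (time_now t) j 0).

Definition Xplus : 'M[R]_(n, \sum_(i < q) T i) :=
  \mxrow_(i < q) (\matrix_(j < n, t < T i) x (time_next t) j 0).

Definition Sigma_is : set ('M[R]_n * 'M[R]_(n, m)) :=
  [set AB | Xplus = row_mx AB.1 AB.2 *m col_mx Xminus Uminus].

Definition Sigma_nil (K : 'M[R]_(m, n)) : set ('M[R]_n * 'M[R]_(n, m)) :=
  [set AB | nilpotent_mx (AB.1 + AB.2 *m K)].

Definition informative_deadbeat : Prop :=
  exists K : 'M[R]_(m, n), Sigma_is `<=` Sigma_nil K.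

End Data.

(* Main.v *)
(* If K makes every consistent system nilpotent, then As + Bs K + C N is
   nilpotent for all C, where N = Z [1; K] and Z spans the left kernel of
   [Xminus; Uminus]. A nonzero N would allow a rank-one C that gives this matrix
   the eigenvalue 1, so N = 0 and [1; K] = [Xminus; Uminus] Xd for some Xd; this
   Xd is the desired right inverse. Conversely, A + B (Uminus Xd) = Xplus Xd for
   every consistent (A, B). *)
Require Import Defs.
From HB Require Import structures.
From mathcomp Require Import all_boot all_order all_algebra.
From mathcomp Require Import classical_sets reals.

Set Implicit Arguments.
Unset Strict Implicit.
Unset Printing Implicit Defensive.

Import GRing.Theory.
Local Open Scope ring_scope.
Local Open Scope classical_set_scope.

Lemma nilpotent_mx_fixed (R : realType) (n p : nat) (M : 'M[R]_n)
    (v : 'M[R]_(n, p)) :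
  nilpotent_mx M -> M *m v = v -> v = 0.
Proof.
move=> [k Mk0] Mv; have Mkv : M ^+ k *m v = v.
  elim: k {Mk0} => [|k IHk]; first by rewrite expr0 mul1mx.
  by rewrite exprS -mulmxA IHk.
by rewrite -Mkv Mk0 mul0mx.
Qed.

Lemma nilpotent_mx_perturb (R : realType) (n p : nat) (M : 'M[R]_n)
    (N : 'M[R]_(p, n)) :
  (forall C : 'M[R]_(n, p), nilpotent_mx (M + C *m N)) -> N = 0.
Proof.
move=> nilM; apply/matrixP => i j; rewrite mxE; apply/eqP/negP => /negP Nij0.
pose v : 'cV[R]_n := delta_mx j 0.
(* The scaling makes [w *m N *m v] equal to 1. *)
pose w : 'rV[R]_p := (N i j)^-1 *: delta_mx 0 i.
have wNv : w *m N *m v = 1%:M.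
  rewrite -!scalemxAl -rowE -colE; apply/matrixP => a b.
  by rewrite !mxE !ord1 eqxx mulVf.
have v0 : v = 0.
  (* With [C = (v - M v) w], the matrix [M + C N] sends [v] to [M v + (v - M v) (w N v) = v]. *)
  apply: nilpotent_mx_fixed (nilM ((v - M *m v) *m w)) _.
  by rewrite mulmxDl -!mulmxA (mulmxA w) wNv mulmx1 addrC subrK.
have /matrixP/(_ j 0)/eqP := v0.
by rewrite !mxE !eqxx oner_eq0.
Qed.

(** The left kernel of [W] is the annihilator of its column space, so whatever it kills has its
    columns in that space. Square [Z] suffice, because the transpose of [cokermx W^T] is the only
    test needed. *)
Lemma left_kernel_factor (F : fieldType) (m n p : nat) (W : 'M[F]_(m, n))
    (V : 'M[F]_(m, p)) :
  (forall Z : 'M[F]_m, Z *m W = 0 -> Z *m V = 0) ->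
  exists Y : 'M[F]_(n, p), V = W *m Y.
Proof.
move=> ker0; have /submxP[D VD] : (V^T <= W^T)%MS.
  rewrite submxE -[cokermx _]trmxK -trmx_mul ker0 ?trmx0 //.
  by apply: trmx_inj; rewrite trmx_mul trmxK mulmx_coker trmx0.
by exists D^T; apply: trmx_inj; rewrite trmx_mul trmxK.
Qed.

Section Deadbeat.
Variables (R : realType) (n m q : nat) (T : 'I_q -> nat).
Variable u : forall i : 'I_q, 'I_(T i) -> 'cV[R]_m.
Variable x : forall i : 'I_q, 'I_(T i).+1 -> 'cV[R]_n.

(** This gives a base point to perturb; over an empty [Sigma_is] the inclusion in [Sigma_nil K]
    would be vacuous. *)
Lemma generated_by_Sigma_is (A : 'M[R]_n) (B : 'M[R]_(n, m)) :
  generated_by u x A B -> Sigma_is u x (A, B).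
Proof.
move=> data; rewrite /Sigma_is /= mul_row_col !mul_mxrow -mxrowD.
apply/eq_mxrow => i; apply/matrixP => j t; rewrite mxE data !mxE.
by congr (_ + _); apply: eq_bigr => k _; rewrite !mxE.
Qed.

Lemma Sigma_is_closed_loop (A : 'M[R]_n) (B : 'M[R]_(n, m))
    (Xd : 'M[R]_(\sum_(i < q) T i, n)) :
  Xminus x *m Xd = 1%:M -> Sigma_is u x (A, B) ->
  Xplus x *m Xd = A + B *m (Uminus u *m Xd).
Proof.
move=> XXd /= ->.
by rewrite mul_row_col mulmxDl -!mulmxA XXd mulmx1.
Qed.

Lemma deadbeat_right_inverse (A : 'M[R]_n) (B : 'M[R]_(n, m))
    (K : 'M[R]_(m, n)) :
  Sigma_is u x (A, B) -> Sigma_is u x `<=` Sigma_nil K ->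
  exists2 Xd : 'M[R]_(\sum_(i < q) T i, n),
    Xminus x *m Xd = 1%:M & Uminus u *m Xd = K.
Proof.
move=> AB nilK.
have [|Xd] := @left_kernel_factor _ _ _ _ (col_mx (Xminus x) (Uminus u))
    (col_mx 1%:M K).
  move=> Z ZW; apply: (@nilpotent_mx_perturb _ _ _ (A + B *m K)) => C.
  (* Since [Z] kills the data, adding the two blocks of [C *m Z] to [A] and [B] preserves
     consistency, and it changes the closed loop by [C Z [1; K]]. *)
  have := nilK (A + lsubmx (C *m Z), B + rsubmx (C *m Z)).
  rewrite /Sigma_is /Sigma_nil /= -add_row_mx hsubmxK mulmxDl.
  rewrite -[C *m Z *m _]mulmxA ZW mulmx0 addr0 => /(_ AB).
  rewrite mulmxDl addrACA -[X in _ + (X + _)]mulmx1 -mul_row_col hsubmxK.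
  by rewrite mulmxA.
by rewrite mul_col_mx => /eq_col_mx[-> ->]; exists Xd.
Qed.

End Deadbeat.

Theorem theorem21 (R : realType) (n m q : nat) (T : 'I_q -> nat)
    (n_gt0 : (0 < n)%N) (m_gt0 : (0 < m)%N) (q_gt0 : (0 < q)%N)
    (T_gt0 : forall i : 'I_q, (0 < T i)%N)
    (As : 'M[R]_n) (Bs : 'M[R]_(n, m))
    (u : forall i : 'I_q, 'I_(T i) -> 'cV[R]_m)
    (x : forall i : 'I_q, 'I_(T i).+1 -> 'cV[R]_n)
    (data : generated_by u x As Bs) :
  (informative_deadbeat u x <->
     row_free (Xminus x) /\
     exists Xd : 'M[R]_(\sum_(i < q) T i, n),
       Xminus x *m Xd = 1%:M /\ nilpotent_mx (Xplus x *m Xd))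
  /\
  (row_free (Xminus x) ->
   forall Xd : 'M[R]_(\sum_(i < q) T i, n),
     Xminus x *m Xd = 1%:M -> nilpotent_mx (Xplus x *m Xd) ->
     Sigma_is u x `<=` Sigma_nil (Uminus u *m Xd)).
Proof.
have AsBs := generated_by_Sigma_is data.
have suff_nil (Xd : 'M[R]_(\sum_(i < q) T i, n)) :
    Xminus x *m Xd = 1%:M -> nilpotent_mx (Xplus x *m Xd) ->
    Sigma_is u x `<=` Sigma_nil (Uminus u *m Xd).
  move=> XXd nilX [A B] /(Sigma_is_closed_loop XXd) eqX.
  by rewrite /Sigma_nil /= -eqX.
split=> [|_]; last exact: suff_nil.
split=> [[K nilK]|[_ [Xd [XXd nilX]]]]; last first.
  by exists (Uminus u *m Xd); apply: suff_nil.
have [Xd XXd UXd] := deadbeat_right_inverse AsBs nilK.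
split; first by apply/row_freeP; exists Xd.
(* As the true system is consistent, [Xplus x *m Xd] is its closed loop [As + Bs K], which [nilK]
   makes nilpotent. *)
exists Xd; split=> //; rewrite (Sigma_is_closed_loop XXd AsBs) UXd.
exact: nilK AsBs.
Qed.
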